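(* Let $N\ge 3$ be an integer and let $B_N$ be the sequence defined by $B_N(n)=n$ for $1\le n\le N$ and, for $n>N$, \[B_N(n)=B_N\bigl(n-B_N(n-1)\bigr)+B_N\bigl(n-B_N(n-2)\bigr)+B_N\bigl(n-B_N(n-3)\bigr),\] where $B_N(n)$ is defined only if $B_N(1),\dots,B_N(n-1)$ are defined and each of the three indices $n-B_N(n-i)$ ($i=1,2,3$) lies in $\{1,2,\dots,n-1\}$. If $N=3$, $N=4$, or $N\ge 10$, then $B_N$ dies (i.e., is a finite sequence). Furthermore, if $N\ge 14$, then $B_N$ has exactly $N+24$ terms.
   Context: A sequence generated this way ''dies'' if some term $B_N(n)$ is undefined (because a required index $n-B_N(n-i)$ is $\le 0$ or $\ge n$); it then has exactly $m$ terms when $B_N(1),\dots,B_N(m)$ are defined and $B_N(m+1)$ is undefined. *)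

(* Defs.v *)
From mathcomp Require Import all_boot.

Set Implicit Arguments.
Unset Strict Implicit.
Unset Printing Implicit Defensive.

(* The value of the term following s = [:: B_N(1); ...; B_N(n-1)], if defined.
   The subtraction n - B (n - i) is truncated, which is harmless here: an
   index that is <= 0 in the integers becomes 0, and 0 is rejected by the test
   0 < index i < n. *)
Definition hof_next (N : nat) (s : seq nat) : option nat :=
  let n := (size s).+1 in
  let B k := nth 0 s k.-1 in
  let index i := n - B (n - i) in
  if n <= N then Some n
  else if [&& 0 < index 1 < n, 0 < index 2 < n & 0 < index 3 < n]
  then Some (B (index 1) + B (index 2) + B (index 3))
  else None.

(* Some [:: B_N(1); ...; B_N(n)] if these n terms are all defined, else None. *)
Fixpoint hof_prefix (N n : nat) : option (seq nat) :=
  if n is m.+1 then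
    if hof_prefix N m is Some s then omap (rcons s) (hof_next N s) else None
  else Some [::].

(* B_N(n), with None for "undefined". Terms are numbered from 1. *)
Definition hof (N n : nat) : option nat :=
  if n is 0 then None else omap (last 0) (hof_prefix N n).

Definition dies (N : nat) : Prop := exists2 n, 0 < n & hof N n = None.

Definition has_exactly_terms (N m : nat) : Prop :=
  (forall n, 0 < n <= m -> hof N n <> None) /\ hof N m.+1 = None.

(* For N >= 3, hof_init, hof_undef and hof_rec below are the defining clauses of
   B_N, and they determine hof N on positive arguments. *)

Lemma hof_prefix_size N n s : hof_prefix N n = Some s -> size s = n.
Proof.
elim: n s => [|n IHn] s /=; first by case=> <-.
case: (hof_prefix N n) IHn => // t /(_ t erefl) szt.
by case: (hof_next N t) => //= v [<-]; rewrite size_rcons szt.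
Qed.

Lemma hof_prefix_nth N n s k :
  hof_prefix N n = Some s -> 0 < k <= n -> hof N k = Some (nth 0 s k.-1).
Proof.
elim: n s => [|n IHn] s; first by case: k.
move=> Es; have szs := hof_prefix_size Es; move: Es => /=.
case Et: (hof_prefix N n) => [t|] //; have szt := hof_prefix_size Et.
case Ev: (hof_next N t) => [v|] //= [Es] /andP[k_gt0].
rewrite leq_eqVlt => /orP[/eqP-> | lt_kn].
  by rewrite /= Et Ev /= -Es last_rcons nth_rcons szt ltnn eqxx.
rewrite (IHn t) ?k_gt0 // -Es nth_rcons szt.
by case: k k_gt0 lt_kn {IHn} => //= k _; rewrite ltnS => ->.
Qed.

Lemma hof_prefix_None N n m :
  n <= m -> hof_prefix N n = None -> hof_prefix N m = None.
Proof.
by move=> /subnK <- En; elim: (m - n) => [|d IHd] //=; rewrite IHd.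
Qed.

Lemma hof_prefixE N n : 0 < n -> (hof N n = None) <-> (hof_prefix N n = None).
Proof. by case: n => // n _; rewrite /hof; case: (hof_prefix N n.+1). Qed.

Lemma hof_prefix_init N n : n <= N -> hof_prefix N n = Some (iota 1 n).
Proof.
elim: n => [|n IHn] //= lt_nN.
by rewrite IHn 1?ltnW // /hof_next size_iota lt_nN /= -cats1 -(iotaD 1 n 1) addn1.
Qed.

Lemma hof_init N n : 0 < n <= N -> hof N n = Some n.
Proof.
case: n => // n /andP[_ le_nN]; rewrite /hof hof_prefix_init //.
by rewrite -[n.+1]addn1 iotaD /= last_cat /= addnC.
Qed.

Lemma hof_undef N k n : 0 < k < n -> hof N k = None -> hof N n = None.
Proof.
move=> /andP[k_gt0 lt_kn] /(hof_prefixE _ k_gt0) Ek.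
apply/hof_prefixE; first exact: leq_ltn_trans lt_kn.
exact: hof_prefix_None (ltnW lt_kn) Ek.
Qed.

Lemma hof_rec N n (b : nat -> nat) :
    3 <= N < n -> (forall k, 0 < k < n -> hof N k = Some (b k)) ->
  hof N n =
    if [&& 0 < n - b (n - 1) < n, 0 < n - b (n - 2) < n
         & 0 < n - b (n - 3) < n]
    then Some (b (n - b (n - 1)) + b (n - b (n - 2)) + b (n - b (n - 3)))
    else None.
Proof.
case: n => [|n] /andP[N_ge3 lt_Nn] Eb; first by [].
have n_ge3 : 3 <= n := leq_trans N_ge3 lt_Nn.
case Es: (hof_prefix N n) => [s|]; last first.
  have n_gt0 : 0 < n := leq_trans (isT : 0 < 3) n_ge3.
  by move/(hof_prefixE _ n_gt0): Es; rewrite Eb // n_gt0 ltnSn.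
have szs := hof_prefix_size Es.
have Es_b k : 0 < k < n.+1 -> nth 0 s k.-1 = b k.
  by move=> kP; have := hof_prefix_nth Es kP; rewrite Eb // => -[].
have Eb_i i : 0 < i <= 3 -> nth 0 s (n.+1 - i).-1 = b (n.+1 - i).
  case/andP=> i_gt0 i_le3; apply: Es_b; rewrite subn_gt0 !ltnS.
  by rewrite (leq_trans i_le3) //= leq_subLR -add1n leq_add2r.
rewrite /hof /= Es /hof_next szs leqNgt lt_Nn /= (Eb_i 1) // (Eb_i 2) // (Eb_i 3) //.
case: ifP => //= /and3P[i1 i2 i3].
by rewrite last_rcons !Es_b.
Qed.

(* Main.v *)
(* For N >= 14 the terms B_N(N + 1), ..., B_N(N + 24) are affine functions of N:
   each index n - B_N(n - i) involved is k with 1 <= k <= 9, N - k with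
   0 <= k <= 4, or N + k with 1 <= k <= 3, so one computation serves every N.
   Since B_N(N + 24) = 2 N + 11 >= N + 25, the next index is not positive; this
   inequality is what forces N >= 14. The values N = 3, 4, 10, ..., 13 are
   settled by direct computation. *)

Require Import Defs.
From mathcomp Require Import all_boot zify.

Lemma hof_defined {N m k a} :
  hof N m = Some a -> 0 < k <= m -> exists v, hof N k = Some v.
Proof.
move=> Em /andP[k_gt0]; rewrite leq_eqVlt => /orP[/eqP-> | lt_km].
  by exists a.
case Ek: (hof N k) => [v|]; first by exists v.
by rewrite (@hof_undef N k m) ?k_gt0 in Em.
Qed.

(** Definedness of the single term [n] suffices because it propagates to all smaller positive
    indices, so the default 0 in [b] is never read there. *)
Lemma hof_rec_odflt {N n a} (b := fun k => odflt 0 (hof N k)) :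
    3 <= N <= n -> hof N n = Some a ->
  hof N n.+1 =
    if [&& 0 < n.+1 - b n < n.+1, 0 < n.+1 - b (n - 1) < n.+1
         & 0 < n.+1 - b (n - 2) < n.+1]
    then Some (b (n.+1 - b n) + b (n.+1 - b (n - 1)) + b (n.+1 - b (n - 2)))
    else None.
Proof.
move=> leNn En; rewrite (@hof_rec N n.+1 b) // => [|k].
  by rewrite !subSS subn0.
by rewrite ltnS => /(hof_defined En)[v]; rewrite /b => ->.
Qed.

(** All positions are variables tied by additive equations: this avoids truncated subtraction, and
    already proved terms apply whatever the shape of their index. Positivity of the [a]'s puts the
    indices below [n]. *)
Lemma hof_step {N n n1 n2 n3 a1 a2 a3 i1 i2 i3 v1 v2 v3 v} :
    hof N n1 = Some a1 -> hof N n2 = Some a2 -> hof N n3 = Some a3 ->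
    hof N i1 = Some v1 -> hof N i2 = Some v2 -> hof N i3 = Some v3 ->
    3 <= N < n /\ n1 + 1 = n /\ n2 + 2 = n /\ n3 + 3 = n ->
    0 < a1 /\ 0 < a2 /\ 0 < a3 ->
    i1 + a1 = n /\ i2 + a2 = n /\ i3 + a3 = n -> v1 + v2 + v3 = v ->
  hof N n = Some v.
Proof.
move=> E1 E2 E3 F1 F2 F3 [leN [En1 [En2 En3]]] a_gt0 [Ei1 [Ei2 Ei3]] <-.
(* [hof N 0] is [None] by convention, so a defined term has a positive index. *)
have i_gt0 i w : hof N i = Some w -> 0 < i by case: i.
move: (i_gt0 _ _ F1) (i_gt0 _ _ F2) (i_gt0 _ _ F3) => i1_gt0 i2_gt0 i3_gt0.
have -> : n = n1.+1 by lia.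
rewrite (hof_rec_odflt _ E1); last by lia.
have -> : n1 - 1 = n2 by lia.
have -> : n1 - 2 = n3 by lia.
rewrite E1 E2 E3 /=.
have -> : n1.+1 - a1 = i1 by lia.
have -> : n1.+1 - a2 = i2 by lia.
have -> : n1.+1 - a3 = i3 by lia.
by rewrite F1 F2 F3 ifT //; lia.
Qed.

Lemma hof_stop {N n a} :
  3 <= N <= n -> hof N n = Some a -> n < a -> hof N n.+1 = None.
Proof.
move=> leNn En lt_na; rewrite (hof_rec_odflt leNn En) En /=.
by have /eqP-> : n.+1 - a == 0 by rewrite subn_eq0.
Qed.

Lemma hof_last {N} : 14 <= N -> hof N (N + 24) = Some (N + N + 11).
Proof.
move=> leN.
have I k : 0 < k <= N -> hof N k = Some k := @hof_init N k.
have h1 : hof N (N + 1) = Some 6.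
  (* Here and below, the first three arguments are the preceding terms, latest first; the last three
     are the terms they point to. *)
  by apply: (hof_step (I N _) (I (N - 1) _) (I (N - 2) _) (I 1 _) (I 2 _) (I 3 _)); lia.
have h2 : hof N (N + 2) = Some (N + 1).
  by apply: (hof_step h1 (I N _) (I (N - 1) _) (I (N - 4) _) (I 2 _) (I 3 _)); lia.
have h3 : hof N (N + 3) = Some (N + 2).
  by apply: (hof_step h2 h1 (I N _) (I 2 _) (I (N - 3) _) (I 3 _)); lia.
have h4 : hof N (N + 4) = Some (N + 3).
  by apply: (hof_step h3 h2 h1 (I 2 _) (I 3 _) (I (N - 2) _)); lia.
have h5 : hof N (N + 5) = Some 9.
  by apply: (hof_step h4 h3 h2 (I 2 _) (I 3 _) (I 4 _)); lia.
have h6 : hof N (N + 6) = Some (N + 4).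
  by apply: (hof_step h5 h4 h3 (I (N - 3) _) (I 3 _) (I 4 _)); lia.
have h7 : hof N (N + 7) = Some (N + 5).
  by apply: (hof_step h6 h5 h4 (I 3 _) (I (N - 2) _) (I 4 _)); lia.
have h8 : hof N (N + 8) = Some (N + 6).
  by apply: (hof_step h7 h6 h5 (I 3 _) (I 4 _) (I (N - 1) _)); lia.
have h9 : hof N (N + 9) = Some 12.
  by apply: (hof_step h8 h7 h6 (I 3 _) (I 4 _) (I 5 _)); lia.
have h10 : hof N (N + 10) = Some (N + 7).
  by apply: (hof_step h9 h8 h7 (I (N - 2) _) (I 4 _) (I 5 _)); lia.
have h11 : hof N (N + 11) = Some (N + 8).
  by apply: (hof_step h10 h9 h8 (I 4 _) (I (N - 1) _) (I 5 _)); lia.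
have h12 : hof N (N + 12) = Some (N + 9).
  by apply: (hof_step h11 h10 h9 (I 4 _) (I 5 _) (I N _)); lia.
have h13 : hof N (N + 13) = Some 15.
  by apply: (hof_step h12 h11 h10 (I 4 _) (I 5 _) (I 6 _)); lia.
have h14 : hof N (N + 14) = Some (N + 10).
  by apply: (hof_step h13 h12 h11 (I (N - 1) _) (I 5 _) (I 6 _)); lia.
have h15 : hof N (N + 15) = Some (N + 11).
  by apply: (hof_step h14 h13 h12 (I 5 _) (I N _) (I 6 _)); lia.
have h16 : hof N (N + 16) = Some 17.
  by apply: (hof_step h15 h14 h13 (I 5 _) (I 6 _) h1); lia.
have h17 : hof N (N + 17) = Some (N + 13).
  by apply: (hof_step h16 h15 h14 (I N _) (I 6 _) (I 7 _)); lia.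
have h18 : hof N (N + 18) = Some 18.
  by apply: (hof_step h17 h16 h15 (I 5 _) h1 (I 7 _)); lia.
have h19 : hof N (N + 19) = Some (N + 13).
  by apply: (hof_step h18 h17 h16 h1 (I 6 _) h2); lia.
have h20 : hof N (N + 20) = Some (N + 15).
  by apply: (hof_step h19 h18 h17 (I 7 _) h2 (I 7 _)); lia.
have h21 : hof N (N + 21) = Some (N + 16).
  by apply: (hof_step h20 h19 h18 (I 6 _) (I 8 _) h3); lia.
have h22 : hof N (N + 22) = Some 22.
  by apply: (hof_step h21 h20 h19 (I 6 _) (I 7 _) (I 9 _)); lia.
have h23 : hof N (N + 23) = Some 21.
  by apply: (hof_step h22 h21 h20 h1 (I 7 _) (I 8 _)); lia.
(* The small terms 21 and 22 point to [N + 3] and [N + 2], whose values both grow with [N]: hence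
   the first term of slope 2 in [N]. *)
by apply: (hof_step h23 h22 h21 h3 h2 (I 8 _)); lia.
Qed.

Lemma hof_exact {N} : 14 <= N -> has_exactly_terms N (N + 24).
Proof.
move=> leN; have Elast := hof_last leN; split=> [n /(hof_defined Elast)[v ->] //|].
by apply: (hof_stop _ Elast); lia.
Qed.

Theorem theorem1 (N : nat) (hN : 3 <= N) :
  ((N = 3 \/ N = 4 \/ 10 <= N) -> dies N) /\
  (14 <= N -> has_exactly_terms N (N + 24)).
Proof.
split=> [N_dies|]; last exact: hof_exact.
have [/hof_exact[_ Enone] | ltN] := leqP 14 N; first by exists (N + 24).+1.
have : N \in [:: 3; 4; 10; 11; 12; 13] by rewrite !inE; lia.
rewrite !inE => /or4P[||| /or3P[]] /eqP->.
(* The witnesses come from running the recurrence. For [N] from 10 to 13 the first index at [N + 25]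
   is [14 - N], still positive, so death comes later and follows no common formula. *)
- by exists 5; vm_compute.
- by exists 6; vm_compute.
- by exists 1016; vm_compute.
- by exists 118; vm_compute.
- by exists 46; vm_compute.
- by exists 74; vm_compute.
Qed.
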